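(* Suppose $(M,g(t))$ is a Ricci flow defined on a finite time interval $[0,T)$, which either satisfies that for every $t\in[0,T)$ there exists $C<\infty$ with $|\mathrm{Rm}|\le C$ on $M\times[0,t]$, or has complete time slices for all $t\in[0,T)$. Then $p\in\Sigma$ if and only if $$r_{\mathrm{Rm}}^{-2}(p,t)>\frac1{T-t}\quad\text{for all }t\in[0,T).$$
   Context: A Ricci flow $(M^n,g(t))_{t\in[0,T)}$ is a smooth one-parameter family of $n$-dimensional Riemannian manifolds with $\partial_t g(t)=-2\mathrm{Ric}_{g(t)}$. $\Sigma$ is the set of singular points: $p\in\Sigma$ if for any neighbourhood $U$ of $p$ the Riemannian curvature becomes unbounded on $U$ as $t$ approaches $T$. Parabolic cylinder: $\mathcal P(p,t,r):=B_{g(t)}(p,r)\times(\max\{t-r^2,0\},\min\{t+r^2,T\})$. Riemann scale: $r_{\mathrm{Rm}}(p,t):=\sup\{r>0 \mid |\mathrm{Rm}|<r^{-2}\text{ on }\mathcal P(p,t,r)\}$, with $r_{\mathrm{Rm}}(p,t)=+\infty$ if $(M,g(t))$ is flat for every $t\in[0,T)$. *)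

(* Defs.v *)
From HB Require Import structures.
From mathcomp Require Import all_boot all_order all_algebra.
From mathcomp Require Import all_classical all_reals all_analysis.
Set Implicit Arguments.
Unset Strict Implicit.
Unset Printing Implicit Defensive.
Import Order.TTheory GRing.Theory Num.Theory numFieldNormedType.Exports.
Local Open Scope classical_set_scope.
Local Open Scope ring_scope.

Section Smoothness.
Context {R : realType} {V W : normedModType R}.

(* Used for U open and V finite-dimensional only. *)
Fixpoint Ck (k : nat) (U : set V) (f : V -> W) : Prop :=
  match k with
  | 0 => forall x, U x -> {for x, continuous f}
  | k'.+1 => (forall x, U x -> differentiable f x) /\
             (forall v : V, Ck k' U (fun x => 'D_v f x))
  end.

Definition smooth (U : set V) (f : V -> W) : Prop := forall k, Ck k U f.

(* Regularity P on an arbitrary subset A: near each point of A, f agrees on A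
   with a function having regularity P on a full neighbourhood. *)
Definition extends (P : set V -> (V -> W) -> Prop) (A : set V) (f : V -> W) :
  Prop :=
  forall a, A a -> exists (U : set V) (h : V -> W),
    [/\ open U, U a, P U h & forall x, U x -> A x -> h x = f x].

End Smoothness.

Section Manifolds.
Context {R : realType}.

Record chart (n : nat) (X : topologicalType) := Chart {
  dom : set X ;
  coord : X -> 'rV[R]_n ;
  param : 'rV[R]_n -> X ;
  dom_open : open dom ;
  codom_open : open (coord @` dom) ;
  coord_cont : forall p, dom p -> {for p, continuous coord} ;
  param_cont : forall x, (coord @` dom) x -> {for x, continuous param} ;
  coordK : forall p, dom p -> param (coord p) = p }.

Definition transition n X (c d : chart n X) : 'rV[R]_n -> 'rV[R]_n :=
  coord d \o param c.

(* An indexed atlas; the function chart_at expresses that the charts cover. *)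
Record manifold (n : nat) := Manifold {
  space :> topologicalType ;
  space_hausdorff : hausdorff_space space ;
  space_second_countable : @second_countable space ;
  idx : Type ;
  atlas : idx -> chart n space ;
  chart_at : space -> idx ;
  chart_at_dom : forall p, dom (atlas (chart_at p)) p ;
  transition_smooth : forall i j,
    smooth (coord (atlas i) @` (dom (atlas i) `&` dom (atlas j)))
           (transition (atlas i) (atlas j)) }.

End Manifolds.

Arguments chart R n X : clear implicits.
Arguments manifold R n : clear implicits.

Section LocalCurvature.
Context {R : realType} {n : nat}.
Implicit Types (G : 'rV[R]_n -> 'M[R]_n) (x : 'rV[R]_n) (i j k l : 'I_n).

Definition partial i (f : 'rV[R]_n -> R) : 'rV[R]_n -> R :=
  fun x => 'D_(delta_mx 0 i) (f : 'rV[R]_n -> R^o) x.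

(* Gamma_{ij}^k *)
Definition christoffel G i j k x : R :=
  2^-1 * \sum_l invmx (G x) k l *
    (partial i (fun y => G y j l) x + partial j (fun y => G y i l) x
     - partial l (fun y => G y i j) x).

(* R_{ijk}^l, where R(d_i, d_j) d_k = \sum_l R_{ijk}^l d_l and
   R(X, Y) = [nabla_X, nabla_Y] - nabla_[X, Y] *)
Definition riem G i j k l x : R :=
  partial i (christoffel G j k l) x - partial j (christoffel G i k l) x
  + \sum_m (christoffel G j k m x * christoffel G i m l x
            - christoffel G i k m x * christoffel G j m l x).

(* Trace of X |-> R(X, d_j) d_k: positive on round spheres. *)
Definition ricci G j k x : R := \sum_i riem G i j k i x.

Definition riem_norm G x : R :=
  Num.sqrt (\sum_i \sum_j \sum_k \sum_l \sum_i' \sum_j' \sum_k' \sum_l'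
    invmx (G x) i i' * invmx (G x) j j' * invmx (G x) k k' * G x l l' *
    riem G i j k l x * riem G i' j' k' l' x).

End LocalCurvature.

Section Riemannian.
Context {R : realType} {n : nat} {M : manifold R n}.

(* A covariant 2-tensor field, given by its component matrices in the charts
   (relevant only on the coordinate images). *)
Definition tensor2 := idx M -> 'rV[R]_n -> 'M[R]_n.

Definition coord_image (i : idx M) : set 'rV[R]_n :=
  coord (atlas i) @` dom (atlas i).

(* With row vectors a tangent vector v transforms into v *m 'J, hence the form
   of the change-of-chart law. *)
Record riemannian_metric (g : tensor2) : Prop := RiemannianMetric {
  metric_sym : forall i x, coord_image i x -> (g i x)^T = g i x ;
  metric_pos : forall i x, coord_image i x -> forall v : 'rV[R]_n,
    v != 0 -> 0 < (v *m g i x *m v^T) 0 0 ;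
  metric_change : forall i j p, dom (atlas i) p -> dom (atlas j) p ->
    let J := jacobian (transition (atlas i) (atlas j)) (coord (atlas i) p) in
    g i (coord (atlas i) p) = J *m g j (coord (atlas j) p) *m J^T ;
  metric_smooth : forall i a b,
    smooth (coord_image i) (fun x => g i x a b : R^o) }.

Definition piecewise_C1 (c : R -> M) : Prop :=
  {within `[0, 1], continuous c} /\
  exists (k : nat) (s : nat -> R),
    [/\ s 0%N = 0, s k = 1 &
        forall j, (j < k)%N -> s j < s j.+1 /\
          forall i : idx M,
            extends (Ck 1) (`[s j, s j.+1] `&` c @^-1` dom (atlas i) : set R^o)
                           (coord (atlas i) \o c)].

(* The norm of c'(s), independent of the chart around c s. *)
Definition speed (g : tensor2) (c : R -> M) (s : R) : R :=
  let i := chart_at (c s) in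
  let v : 'rV[R]_n := derive1 (coord (atlas i) \o c) s in
  Num.sqrt ((v *m g i (coord (atlas i) (c s)) *m v^T) 0 0).

Definition curve_length (g : tensor2) (c : R -> M) : \bar R :=
  (\int[lebesgue_measure]_(s in `[0%R, 1%R]) (speed g c s)%:E)%E.

(* +oo for points in different connected components *)
Definition dist (g : tensor2) (p q : M) : \bar R :=
  ereal_inf [set curve_length g c | c in
    [set c : R -> M | [/\ piecewise_C1 c, c 0 = p & c 1 = q]]].

Definition metric_ball (g : tensor2) (p : M) (r : R) : set M :=
  [set q | (dist g p q < r%:E)%E].

Definition complete_metric (g : tensor2) : Prop :=
  forall u : nat -> M,
    (forall e : R, 0 < e -> exists N : nat, forall m k : nat,
       (N <= m)%N -> (N <= k)%N -> (dist g (u m) (u k) < e%:E)%E) ->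
    exists q : M, forall e : R, 0 < e -> exists N : nat, forall m : nat,
      (N <= m)%N -> (dist g (u m) q < e%:E)%E.

Definition flat (g : tensor2) : Prop :=
  forall i x, coord_image i x -> forall a b c d, riem (g i) a b c d x = 0.

(* g is a smooth family on [0, T) (up to and including t = 0) solving the Ricci
   flow equation, the time derivative being one-sided at t = 0. *)
Record ricci_flow (T : R) (g : R -> tensor2) : Prop := RicciFlow {
  flow_metric : forall t, 0 <= t < T -> riemannian_metric (g t) ;
  flow_smooth : forall i a b,
    extends (@smooth R (R^o * 'rV[R]_n)%type R^o)
      [set z | 0 <= z.1 < T /\ coord_image i z.2]
      (fun z => g z.1 i z.2 a b) ;
  flow_eq : forall t, 0 <= t < T -> forall i x, coord_image i x ->
    forall a b,
      (s - t)^-1 * (g s i x a b - g t i x a b)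
        @[s --> within [set s | 0 <= s < T] t^']
      --> - 2 * ricci (g t i) a b x }.

(* |Rm| < K, resp. |Rm| <= K, on a subset A of space-time. As |Rm| does not
   depend on the chart, it is evaluated in every chart around the point. *)
Definition Rm_lt (g : R -> tensor2) (A : set (M * R)) (K : R) : Prop :=
  forall q s, A (q, s) -> forall i, dom (atlas i) q ->
    riem_norm (g s i) (coord (atlas i) q) < K.

Definition Rm_le (g : R -> tensor2) (A : set (M * R)) (K : R) : Prop :=
  forall q s, A (q, s) -> forall i, dom (atlas i) q ->
    riem_norm (g s i) (coord (atlas i) q) <= K.

(* Unboundedness as t -> T: no bound holds on any U x [tau, T). *)
Definition singular_set (T : R) (g : R -> tensor2) : set M :=
  [set p | forall U : set M, nbhs p U ->
     forall tau, 0 <= tau < T -> ~ exists K : R, Rm_le g (U `*` `[tau, T[) K].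

Definition parabolic_cylinder (T : R) (g : R -> tensor2) (p : M) (t r : R) :
  set (M * R) :=
  metric_ball (g t) p r `*`
  `]Num.max (t - r ^+ 2) 0, Num.min (t + r ^+ 2) T[.

(* The supremum is taken in [0, +oo]: maxe only matters for the empty set. *)
Definition riemann_scale (T : R) (g : R -> tensor2) (p : M) (t : R) : \bar R :=
  if `[< forall s, 0 <= s < T -> flat (g s) >] then +oo%E
  else maxe 0%E (ereal_sup [set r%:E | r in
    [set r : R | 0 < r /\
       Rm_lt g (parabolic_cylinder T g p t r) (r ^- 2)]]).

End Riemannian.

Arguments tensor2 {R n} M.

(* Main.v *)
Require Import Defs.
From mathcomp Require Import all_boot all_order all_algebra.
From mathcomp Require Import all_classical all_reals all_analysis.
From mathcomp Require Import ring lra.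
(* mathcomp's vector.coord shadows the chart map Defs.coord. *)
Import Defs.
Set Implicit Arguments.
Unset Strict Implicit.
Unset Printing Implicit Defensive.
Import Order.TTheory GRing.Theory Num.Theory numFieldNormedType.Exports.
Local Open Scope classical_set_scope.
Local Open Scope ring_scope.

(* If r_Rm(p,t)^2 >= T - t, then |Rm| <= 1/(T-t) on the g(t)-ball of radius
   sqrt(T-t) times (t,T); metric balls are neighbourhoods (compare with straight
   lines in a chart), so p is not singular.  Conversely, suppose |Rm| <= K on
   U x [tau,T).  In a g(t)-orthonormal frame |Ric(v,v)| <= n^3 |Rm| g(v,v), so
   along the flow d/dt g(v,v) >= -2 n^3 K g(v,v) on U, and by Gronwall the metrics
   g(t) stay uniformly coercive in a chart around p up to time T.  Any curve from
   p leaving U first crosses a fixed coordinate sphere, hence has g(t)-length at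
   least some r independent of t, and the g(t)-ball of radius sqrt(T-t) lies in U
   for t close to T; there r_Rm(p,t) >= sqrt(T-t). *)

(** * Positive definite forms and the Ricci bound *)

(** The radius sqrt(T-t) is the one whose parabolic cylinder at time t just reaches the final time,
    so a bound at a single t controls the curvature up to T. In the converse the danger is that g(t)
    shrinks as t tends to T, letting balls of a fixed radius spill out of U; degeneration from below
    is what has to be excluded. The curvature bound holds on U alone, so lengths can be compared
    only along the initial part of a curve, before its first exit from a coordinate ball inside U.
    The Ricci estimate must have a constant depending on n and K alone: an estimate through
    coordinate components would bring in the entries of g(t), whose control is the very aim of the
    Gronwall argument. An orthonormal frame achieves this, since there every component of a tensor
    is at most its norm; n^3 counts the two indices of Ric and the traced one. *)

Lemma normr_sum_le (R : realType) n (f : 'I_n -> R) (B : R) :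
  (forall i, `|f i| <= B) -> `|\sum_i f i| <= n%:R * B.
Proof.
move=> fB; apply: le_trans (ler_norm_sum _ _ _) _.
apply: le_trans (ler_sum _ (fun i _ => fB i)) _.
by rewrite sumr_const card_ord mulr_natl.
Qed.

Definition qform (R : realType) n (G : 'M[R]_n) (v : 'rV[R]_n) : R :=
  (v *m G *m v^T) 0 0.

Definition pos_def (R : realType) n (G : 'M[R]_n) : Prop :=
  G^T = G /\ forall v : 'rV[R]_n, v != 0 -> 0 < qform G v.

(** Induction by eliminating the first basis vector: [E] clears the off-diagonal blocks, and the
    Schur complement [S] inherits positivity because its value at [v] is that of [G] at
    [row_mx 0 v *m E]. The rows of [P] are the frame. *)
Lemma orthonormal_frame (R : realType) n (G : 'M[R]_n) :
  pos_def G -> exists P : 'M[R]_n, P *m G *m P^T = 1%:M.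
Proof.
elim: n G => [|n IH] G [symG posG].
  by exists 0; apply/matrixP => -[].
move: symG posG; rewrite -[n.+1]/(1 + n)%N in G * => symG posG.
pose a := G 0 0.
pose b : 'rV[R]_n := ursubmx G.
have dlE : dlsubmx G = b^T by rewrite /b trmx_ursub symG.
have ulE : ulsubmx G = a%:M.
  apply/matrixP => i j; rewrite !ord1 !mxE/= mulr1n /a.
  by congr (G _ _); apply/val_inj.
have GE : G = block_mx a%:M b b^T (drsubmx G) by rewrite -{1}[G]submxK ulE dlE.
have symD : (drsubmx G)^T = drsubmx G by rewrite trmx_drsub symG.
have a_gt0 : 0 < a.
  have := posG (delta_mx 0 0); rewrite /qform.
  rewrite -rowE trmx_delta -colE !mxE; apply.
  apply/eqP => /matrixP /(_ 0 0); rewrite !mxE eqxx => /eqP.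
  by rewrite oner_eq0.
have a_neq0 : a != 0 by rewrite gt_eqF.
pose S := drsubmx G - a^-1 *: (b^T *m b).
pose E : 'M[R]_(1 + n) := block_mx 1%:M 0 (- a^-1 *: b^T) 1%:M.
have EGE : E *m G *m E^T = block_mx a%:M 0 0 S.
  rewrite GE /E tr_block_mx !mulmx_block !trmx1 !linearZ/= trmxK trmx0.
  rewrite !mul1mx !mul0mx !mulmx1 !addr0 !mulmx0 !addr0.
  rewrite -!scalemxAl mul_scalar_mx mul_mx_scalar.
  rewrite !scalerA mulNr mulVf// !scaleN1r !addNr mul0mx scaler0 add0r.
  by rewrite addrC scaleNr.
have posS : pos_def S.
  split.
    by rewrite /S linearB/= linearZ/= trmx_mul trmxK symD.
  move=> v v0.
  have := posG (row_mx 0 v *m E); rewrite /qform.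
  rewrite trmx_mul !mulmxA -(mulmxA _ E) -(mulmxA _ (E *m G)) EGE.
  rewrite (mul_row_block 0 v a%:M) !mul0mx mulmx0 addr0 add0r.
  rewrite (tr_row_mx 0 v) (mul_row_col 0 (v *m S)) trmx0 mulmx0 add0r; apply.
  rewrite /E mul_row_block mul0mx add0r mulmx1 mul0mx add0r.
  by apply: contra v0 => /eqP /(congr1 rsubmx); rewrite row_mxKr linear0 => ->.
have [P PSP] := IH S posS.
exists (block_mx (Num.sqrt a)^-1%:M 0 0 P *m E).
rewrite trmx_mul !mulmxA -(mulmxA _ E) -(mulmxA _ (E *m G)) EGE.
rewrite tr_block_mx !mulmx_block !trmx0 !mulmx0 !mul0mx !addr0 !add0r.
rewrite PSP tr_scalar_mx -!scalar_mxM.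
rewrite mulrAC -invfM -expr2 sqr_sqrtr ?ltW// mulVf//.
by rewrite !mul0mx -scalar_mx_block.
Qed.

Section RicciBound.
Context {R : realType} {n : nat}.
Implicit Types (G P : 'M[R]_n) (T : 'I_n -> 'I_n -> 'I_n -> 'I_n -> R).

(** The radicand of [riem_norm], with an arbitrary array in place of the curvature components. *)
Definition tensor_normsq G T : R :=
  \sum_i \sum_j \sum_k \sum_l \sum_i' \sum_j' \sum_k' \sum_l'
    invmx G i i' * invmx G j j' * invmx G k k' * G l l' *
    T i j k l * T i' j' k' l'.

(** Components in the frame given by the rows of [P]: the three covariant slots transform by [P],
    the contravariant last one by its inverse. *)
Definition frame_tensor P T (a b c d : 'I_n) : R :=
  \sum_i \sum_j \sum_k \sum_l
    P a i * P b j * P c k * invmx P l d * T i j k l.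

Lemma frame_invmx G P : P *m G *m P^T = 1%:M ->
  P \in unitmx /\ invmx G = P^T *m P /\ G = invmx P *m (invmx P)^T.
Proof.
move=> PGP; have uP : P \in unitmx.
  by move: PGP; rewrite -mulmxA => /mulmx1_unit[].
have uPT : P^T \in unitmx by rewrite unitmx_tr.
have GE : G = invmx P *m (invmx P)^T.
  rewrite trmx_inv -[LHS](mulKmx uP) -[in LHS](mulmxK uPT (P *m G)) PGP.
  by rewrite mul1mx.
split=> //; split=> //.
have uG : G \in unitmx by rewrite GE unitmx_mul unitmx_tr unitmx_inv uP.
apply: (can_inj (mulmxK uG)); rewrite mulVmx// [in RHS]GE !mulmxA.
by rewrite -(mulmxA P^T) mulmxV// mulmx1 -trmx_mul mulVmx// trmx1.
Qed.

Lemma sum4_pair (f : 'I_n -> 'I_n -> 'I_n -> 'I_n -> R) :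
  \sum_i \sum_j \sum_k \sum_l f i j k l =
  \sum_(p : 'I_n * 'I_n * 'I_n * 'I_n) f p.1.1.1 p.1.1.2 p.1.2 p.2.
Proof. by rewrite !pair_bigA. Qed.

(** The factorization of [H] as transpose of [A] times [A], over any finite index type so that
    tensor products amount to pairing indices. *)
Definition gram (I : finType) (A H : I -> I -> R) :=
  forall i i', \sum_a A a i * A a i' = H i i'.

Lemma gram_sumsq (I : finType) (A H : I -> I -> R) (u : I -> R) : gram A H ->
  \sum_a (\sum_i A a i * u i) ^+ 2 = \sum_i \sum_i' H i i' * u i * u i'.
Proof.
move=> AH; under eq_bigr do rewrite expr2 big_distrlr/=.
rewrite exchange_big/=; apply: eq_bigr => i _.
rewrite exchange_big/=; apply: eq_bigr => i' _.
by rewrite -AH !mulr_suml; apply: eq_bigr => a _; ring.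
Qed.

Lemma gram_prod (I J : finType) (A H : I -> I -> R) (B K : J -> J -> R) :
  gram A H -> gram B K ->
  gram (fun a i : I * J => A a.1 i.1 * B a.2 i.2)
       (fun i i' => H i.1 i'.1 * K i.2 i'.2).
Proof.
move=> AH BK [i j] [i' j']/=; rewrite -AH -BK big_distrlr/= pair_bigA/=.
by apply: eq_bigr => a _; ring.
Qed.

(** The weight in the norm is a product of four Gram kernels, three copies of [invmx G] factored by
    [P] and one of [G] factored by [invmx P]; hence the eightfold sum is a sum of squares. *)
Lemma tensor_normsq_frame G P T : P *m G *m P^T = 1%:M ->
  tensor_normsq G T =
  \sum_a \sum_b \sum_c \sum_d frame_tensor P T a b c d ^+ 2.
Proof.
move=> /frame_invmx[uP [iG GE]].
have gP : gram (fun a i => P a i) (fun i i' => invmx G i i').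
  by move=> i i'; rewrite iG mxE; apply: eq_bigr => a _; rewrite mxE.
have gQ : gram (fun a i => invmx P i a) (fun i i' => G i i').
  move=> i i'; rewrite [in RHS]GE mxE.
  by apply: eq_bigr => a _; rewrite [in RHS]mxE.
have g4 := gram_prod (gram_prod (gram_prod gP gP) gP) gQ.
rewrite sum4_pair /tensor_normsq sum4_pair.
transitivity (\sum_p \sum_q invmx G p.1.1.1 q.1.1.1 * invmx G p.1.1.2 q.1.1.2 *
   invmx G p.1.2 q.1.2 * G p.2 q.2 *
   T p.1.1.1 p.1.1.2 p.1.2 p.2 * T q.1.1.1 q.1.1.2 q.1.2 q.2).
  by apply: eq_bigr => p _; rewrite sum4_pair.
rewrite -(gram_sumsq (fun p => T p.1.1.1 p.1.1.2 p.1.2 p.2) g4)/=.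
by apply: eq_bigr => p _; rewrite /frame_tensor sum4_pair.
Qed.

(** The traced slots are one covariant and one contravariant, so [P] and [invmx P] cancel in
    them. *)
Lemma frame_tensor_trace P T (b c : 'I_n) : P \in unitmx ->
  \sum_a frame_tensor P T a b c a =
  \sum_j \sum_k P b j * P c k * \sum_i T i j k i.
Proof.
move=> uP.
rewrite /frame_tensor.
transitivity (\sum_j \sum_k \sum_i \sum_l
    P b j * P c k * T i j k l * \sum_a (invmx P l a * P a i)).
  rewrite exchange_big/=.
  transitivity (\sum_i \sum_j \sum_k \sum_l \sum_a
     P a i * P b j * P c k * invmx P l a * T i j k l).
    apply: eq_bigr => i _; rewrite exchange_big/=; apply: eq_bigr => j _.
    by rewrite exchange_big/=; apply: eq_bigr => k _; rewrite exchange_big.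
  rewrite exchange_big/=; apply: eq_bigr => j _.
  rewrite exchange_big/=; apply: eq_bigr => k _.
  apply: eq_bigr => i _; apply: eq_bigr => l _; rewrite mulr_sumr.
  by apply: eq_bigr => a _; ring.
apply: eq_bigr => j _; apply: eq_bigr => k _; rewrite mulr_sumr.
apply: eq_bigr => i _.
under eq_bigr => l _.
  have -> : \sum_a (invmx P l a * P a i) = (invmx P *m P) l i by rewrite mxE.
  rewrite mulVmx// mxE; over.
rewrite (bigD1 i)//= eqxx mulr1 big1 ?addr0// => l li.
by rewrite (negPf li) mulr0.
Qed.
Lemma frame_tensor_le G P T a b c d : P *m G *m P^T = 1%:M ->
  `|frame_tensor P T a b c d| <= Num.sqrt (tensor_normsq G T).
Proof.
move=> PGP; rewrite -sqrtr_sqr ler_wsqrtr// (tensor_normsq_frame _ PGP).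
rewrite (sum4_pair (fun a b c d => frame_tensor P T a b c d ^+ 2)).
rewrite (bigD1 (a, b, c, d))//= lerDl.
by apply: sumr_ge0 => p _; rewrite sqr_ge0.
Qed.

Lemma qform_frame G P (w : 'rV[R]_n) : P *m G *m P^T = 1%:M ->
  qform G (w *m P) = \sum_i w 0 i ^+ 2.
Proof.
move=> PGP; rewrite /qform trmx_mul !mulmxA -(mulmxA w) -(mulmxA w) PGP mulmx1.
by rewrite mxE; apply: eq_bigr => i _; rewrite mxE expr2.
Qed.

Lemma frame_coord_le G P (w : 'rV[R]_n) i : P *m G *m P^T = 1%:M ->
  `|w 0 i| <= Num.sqrt (qform G (w *m P)).
Proof.
move=> PGP; rewrite -sqrtr_sqr ler_wsqrtr// (qform_frame _ PGP).
by rewrite (bigD1 i)//= lerDl sumr_ge0// => j _; rewrite sqr_ge0.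
Qed.

(** In an orthonormal frame each of the n^3 terms is at most the tensor norm times two frame
    coordinates of [v], and each of these is at most the square root of [qform G v]. For the
    curvature tensor the left side is |Ric(v,v)|. *)
Lemma trace_form_le G T (v : 'rV[R]_n) : pos_def G ->
  `|\sum_j \sum_k v 0 j * v 0 k * \sum_i T i j k i| <=
  n%:R ^+ 3 * Num.sqrt (tensor_normsq G T) * qform G v.
Proof.
move=> pG; have [P PGP] := orthonormal_frame pG.
have [uP _] := frame_invmx PGP.
pose w := v *m invmx P; have vE : v = w *m P by rewrite mulmxKV.
have q0 : 0 <= qform G v.
  by rewrite vE (qform_frame _ PGP) sumr_ge0// => i _; rewrite sqr_ge0.
have -> : \sum_j \sum_k v 0 j * v 0 k * \sum_i T i j k i =
    \sum_b \sum_c w 0 b * w 0 c * \sum_a frame_tensor P T a b c a.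
  under [RHS]eq_bigr do under eq_bigr do rewrite frame_tensor_trace//.
  transitivity (\sum_j \sum_k \sum_b \sum_c
     w 0 b * w 0 c * (P b j * P c k * \sum_i T i j k i)).
    apply: eq_bigr => j _; apply: eq_bigr => k _.
    rewrite vE !mxE big_distrlr/= mulr_suml; apply: eq_bigr => b _.
    by rewrite mulr_suml; apply: eq_bigr => c _; ring.
  rewrite pair_bigA exchange_big/=; apply: eq_bigr => b _.
  rewrite exchange_big/=; apply: eq_bigr => c _.
  rewrite mulr_sumr -(pair_bigA _ (fun j k =>
    w 0 b * w 0 c * (P b j * P c k * \sum_i T i j k i)))/=.
  by apply: eq_bigr => j _; rewrite mulr_sumr.
set N := Num.sqrt _.
have bnd b c a : `|w 0 b * w 0 c * frame_tensor P T a b c a| <= N * qform G v.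
  rewrite !normrM mulrC ler_pM ?mulr_ge0 ?frame_tensor_le//.
  by rewrite -[qform G v]sqr_sqrtr// expr2 vE ler_pM// frame_coord_le.
rewrite -mulrA exprS expr2 -!mulrA.
apply: normr_sum_le => b; apply: normr_sum_le => c; rewrite mulr_sumr.
exact: normr_sum_le.
Qed.

End RicciBound.

(** * Quadratic forms against the sup norm of row vectors *)

Lemma qformE (R : realType) n (G : 'M[R]_n) (v : 'rV[R]_n) :
  qform G v = \sum_i \sum_j v 0 i * v 0 j * G i j.
Proof.
rewrite /qform mxE exchange_big/=; apply: eq_bigr => i _.
rewrite !mxE mulr_suml; apply: eq_bigr => j _; ring.
Qed.

Lemma coord_le_norm (R : realType) n (v : 'rV[R]_n) i : `|v 0 i| <= `|v|.
Proof.
rewrite [leRHS]/Num.norm/= mx_normrE.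
exact: (le_bigmax _ (fun ij : 'I_1 * 'I_n => `|v ij.1 ij.2|) (0, i)).
Qed.

Lemma norm_row_le (R : realType) n (v : 'rV[R]_n) (B : R) :
  0 <= B -> (forall i, `|v 0 i| <= B) -> `|v| <= B.
Proof.
move=> B0 vB; rewrite [leLHS]/Num.norm/= mx_normrE.
by apply: bigmax_le => // -[i j] _; rewrite ord1.
Qed.

Lemma qform_le_norm (R : realType) n (G : 'M[R]_n) (v : 'rV[R]_n) (B : R) :
  (forall i j, `|G i j| <= B) -> `|qform G v| <= n%:R ^+ 2 * B * `|v| ^+ 2.
Proof.
move=> GB; rewrite qformE expr2 -!mulrA.
apply: normr_sum_le => i; apply: normr_sum_le => j.
by rewrite !normrM mulrC ler_pM ?mulr_ge0// expr2 ler_pM// coord_le_norm.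
Qed.

(** The frame coordinates of [v] are bounded by the square root of the form, and going back to [v]
    through [P] costs at most a factor n times a bound of the entries of [P]. *)
Lemma pos_def_coercive (R : realType) n (G : 'M[R]_n) : pos_def G ->
  exists2 c : R, 0 < c & forall v, c * `|v| ^+ 2 <= qform G v.
Proof.
move=> pG; have [P PGP] := orthonormal_frame pG.
have [uP _] := frame_invmx PGP.
pose B := \sum_i \sum_j `|P i j|.
have PB i j : `|P i j| <= B.
  rewrite /B (bigD1 i)//= (bigD1 j)//= -addrA lerDl addr_ge0//.
    exact: sumr_ge0.
  by apply: sumr_ge0 => k _; apply: sumr_ge0.
have B0 : 0 <= B by apply: sumr_ge0 => k _; apply: sumr_ge0.
pose C := n%:R * B + 1.
have C0 : 0 < C by rewrite ltr_wpDl// mulr_ge0.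
exists (C ^+ 2)^-1 => [|v]; first by rewrite invr_gt0 exprn_gt0.
rewrite mulrC ler_pdivrMr ?exprn_gt0//.
pose w := v *m invmx P; have vE : v = w *m P by rewrite mulmxKV.
have q0 : 0 <= qform G v.
  by rewrite vE (qform_frame _ PGP) sumr_ge0// => i _; rewrite sqr_ge0.
have sC0 : 0 <= Num.sqrt (qform G v) * C by rewrite mulr_ge0 ?sqrtr_ge0// ltW.
rewrite -[qform G v]sqr_sqrtr// -exprMn ler_sqr ?nnegrE//.
apply: norm_row_le => // i.
rewrite {1}vE mxE.
apply: le_trans (normr_sum_le (B := B * Num.sqrt (qform G v)) _) _ => [j|].
  by rewrite normrM mulrC ler_pM// vE frame_coord_le.
by rewrite mulrA [leRHS]mulrC ler_wpM2r ?sqrtr_ge0// lerDl.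
Qed.

Lemma near_entries (R : realType) n (T : topologicalType) (F : T -> 'M[R]_n)
    (x0 : T) (e : R) : 0 < e ->
  (forall i j, {for x0, continuous (fun x => F x i j)}) ->
  \forall x \near x0, forall i j, `|F x0 i j - F x i j| <= e.
Proof.
move=> e0 cF; apply: filter_forall => i; apply: filter_forall => j.
by have /cvgrPdist_le/(_ e e0) := cF i j.
Qed.

(** Changing the entries by at most e changes the form by at most n^2 e |v|^2; e is chosen so that
    this uses up half of the constant at [x0]. *)
Lemma pos_def_coercive_near (R : realType) n (T : topologicalType)
    (F : T -> 'M[R]_n) (x0 : T) : pos_def (F x0) ->
  (forall i j, {for x0, continuous (fun x => F x i j)}) ->
  exists2 c : R, 0 < c &
    \forall x \near x0, forall v, c * `|v| ^+ 2 <= qform (F x) v.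
Proof.
move=> /pos_def_coercive[c c0 cq] cF; exists (c / 2); first by rewrite divr_gt0.
pose N : R := n%:R ^+ 2 + 1.
have N0 : 0 < N by rewrite ltr_wpDl// exprn_ge0.
have e0 : 0 < c / 2 / N by rewrite !divr_gt0.
apply: filterS (near_entries e0 cF) => x xe v.
have -> : qform (F x) v = qform (F x0) v - qform (F x0 - F x) v.
  by rewrite /qform mulmxBr mulmxBl !mxE; ring.
have : `|qform (F x0 - F x) v| <= c / 2 * `|v| ^+ 2.
  have xe' i j : `|(F x0 - F x) i j| <= c / 2 / N by rewrite !mxE.
  apply: le_trans (qform_le_norm v xe') _; rewrite ler_wpM2r// ?exprn_ge0//.
  by rewrite mulrA ler_pdivrMr// mulrC ler_wpM2l ?divr_ge0 ?(ltW c0)// lerDl.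
move=> /ler_normlP[_]; have := cq v.
have -> : c * `|v| ^+ 2 = c / 2 * `|v| ^+ 2 + c / 2 * `|v| ^+ 2 by field.
lra.
Qed.

Lemma qform_bounded_near (R : realType) n (T : topologicalType)
    (F : T -> 'M[R]_n) (x0 : T) :
  (forall i j, {for x0, continuous (fun x => F x i j)}) ->
  exists2 C : R, 0 < C &
    \forall x \near x0, forall v, qform (F x) v <= C * `|v| ^+ 2.
Proof.
move=> cF; pose B := \sum_i \sum_j `|F x0 i j| + 1.
have S0 : 0 <= \sum_i \sum_j `|F x0 i j|.
  by apply: sumr_ge0 => k _; apply: sumr_ge0.
have B0 : 0 < B by rewrite ltr_wpDl.
exists (n%:R ^+ 2 * B + 1); first by rewrite ltr_wpDl// mulr_ge0 ?exprn_ge0// ltW.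
apply: filterS (near_entries ltr01 cF) => x xe v.
apply: le_trans (ler_norm _) _.
apply: le_trans (qform_le_norm (B := B) v _) _; last first.
  by rewrite ler_wpM2r ?exprn_ge0// lerDl.
move=> i j; have : `|F x0 i j| <= \sum_i \sum_j `|F x0 i j|.
  rewrite (bigD1 i)//= (bigD1 j)//= -addrA lerDl addr_ge0//.
    exact: sumr_ge0.
  by apply: sumr_ge0 => k _; apply: sumr_ge0.
have := xe i j; have := ler_distD (F x0 i j) (F x i j) 0.
by rewrite !subr0 distrC /B; lra.
Qed.

(** * One-variable analysis *)

(** The hypothesis says that [expR (k * t) * f t] has a nonnegative derivative. *)
Lemma gronwall_lower (R : realType) (f : R -> R) (k a b : R) : a <= b ->
  (forall t, a <= t <= b -> derivable f t 1 /\ - k * f t <= derive1 f t) ->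
  expR (- k * (b - a)) * f a <= f b.
Proof.
move=> ab Hf; pose h (t : R) := expR (k * t) * f t.
have dexp (t : R) : is_derive t 1 (fun t => expR (k * t)) (k * expR (k * t)).
  have dk : is_derive t 1 (fun t : R => k * t) k.
    have H := is_deriveM (is_derive_cst k t 1) (is_derive_id t 1).
    by apply: is_derive_eq H _; rewrite scaler0 addr0 /GRing.scale/= mulr1.
  by have := is_derive1_comp (is_derive_expR (k * t)) dk; rewrite mulrC.
have dh t : a <= t <= b -> is_derive t 1 h (k * expR (k * t) * f t
    + expR (k * t) * derive1 f t).
  move=> /Hf[df _]; have {}df : is_derive t 1 f (derive1 f t).
    by rewrite derive1E; apply: DeriveDef.
  have H := is_deriveM (dexp t) df.
  apply: is_derive_eq H _; rewrite /GRing.scale/= addrC; congr (_ + _).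
  exact: mulrC.
have : h a <= h b.
  apply: (@ger0_derive1_le_cc R h a b) => //; rewrite ?in_itv/= ?lexx ?ab//.
  - move=> t; rewrite in_itv/= => /andP[/ltW ta /ltW tb].
    by apply: ex_derive; apply: dh; rewrite ta tb.
  - move=> t; rewrite in_itv/= => /andP[/ltW ta /ltW tb].
    have tab : a <= t <= b by rewrite ta tb.
    rewrite derive1E (@derive_val _ _ _ _ _ _ _ (dh t tab)).
    have -> : k * expR (k * t) * f t + expR (k * t) * derive1 f t =
        expR (k * t) * (k * f t + derive1 f t) by ring.
    by rewrite mulr_ge0 ?expR_ge0//; have [_] := Hf t tab; lra.
  - apply: derivable_within_continuous => t; rewrite in_itv/= => tab.
    by apply: ex_derive; apply: dh.
rewrite /h -(@ler_pM2l _ (expR (- (k * b)))) ?expR_gt0//.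
rewrite !mulrA -!expRD addNr expR0 mul1r.
by congr (expR _ * _ <= _); ring.
Qed.

(* No measurability is assumed: the library's integral of a nonnegative function
   is the supremum over simple minorants, and the speed of a curve, which is
   evaluated in arbitrarily chosen charts, need not be known to be measurable. *)
Section LowerIntegral.
Import HBNNSimple.
Local Open Scope ereal_scope.
Context d (T : measurableType d) (R : realType).
Variable mu : {measure set T -> \bar R}.
Implicit Types (A B : set T) (f g : T -> \bar R).

Lemma ge0_le_subset_integral A B f g : A `<=` B ->
  (forall x, A x -> 0 <= f x) -> (forall x, B x -> 0 <= g x) ->
  (forall x, A x -> f x <= g x) ->
  \int[mu]_(x in A) f x <= \int[mu]_(x in B) g x.
Proof.
move=> AB f0 g0 fg; rewrite !ge0_integralE//.
apply: le_ereal_sup => _ [h /= hf <-]; exists h => // x.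
apply: le_trans (hf x) _; rewrite /patch.
case: ifPn => [/set_mem xA|_].
  by rewrite mem_set; [exact: fg | exact: AB].
by case: ifPn => [/set_mem/g0|_].
Qed.

(** Superadditivity, the half of additivity that survives for lower integrals: simple minorants on
    [A] and on [B] add up to one on the disjoint union. *)
Lemma ge0_integral_setU_le A B f : A `&` B = set0 ->
  (forall x, (A `|` B) x -> 0 <= f x) ->
  \int[mu]_(x in A) f x + \int[mu]_(x in B) f x <=
  \int[mu]_(x in A `|` B) f x.
Proof.
move=> AB0 f0.
have fA x : A x -> 0 <= f x by move=> ?; apply: f0; left.
have fB x : B x -> 0 <= f x by move=> ?; apply: f0; right.
have sA : \int[mu]_(x in A) f x <= \int[mu]_(x in A `|` B) f x.
  by apply: ge0_le_subset_integral => //; exact: subsetUl.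
have sB : \int[mu]_(x in B) f x <= \int[mu]_(x in A `|` B) f x.
  by apply: ge0_le_subset_integral => //; exact: subsetUr.
have [->|] := eqVneq (\int[mu]_(x in A `|` B) f x) +oo; first exact: leey.
rewrite -ltey => ltU.
have finA : \int[mu]_(x in A) f x \is a fin_num.
  by rewrite ge0_fin_numE ?integral_ge0// (le_lt_trans sA).
have finB : \int[mu]_(x in B) f x \is a fin_num.
  by rewrite ge0_fin_numE ?integral_ge0// (le_lt_trans sB).
(* The two suprema are treated one after the other; moving the other term across the inequality
   needs the finiteness just shown. *)
rewrite -leeBrDr// [leLHS]ge0_integralE//.
apply: ge_ereal_sup => _ [h hf <-].
have fh : sintegral mu h \is a fin_num.
  rewrite ge0_fin_numE ?sintegral_ge0// (@le_lt_trans _ _ (\int[mu]_(x in A) f x))//.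
    by rewrite ge0_integralE//; apply: ereal_sup_ubound; exists h.
  by rewrite (le_lt_trans sA).
rewrite leeBrDr// addeC -leeBrDr// [leLHS]ge0_integralE//.
apply: ge_ereal_sup => _ [k kf <-]; rewrite leeBrDr// -sintegralD//.
rewrite ge0_integralE//; apply: ereal_sup_ubound => /=.
exists (k \+ h)%R => // x /=.
rewrite EFinD addeC; move: (hf x) (kf x); rewrite /patch in_setU.
case: ifPn => [/set_mem xA|_]; case: ifPn => [/set_mem xB|_]//= hx kx.
- by have : (A `&` B) x by []; rewrite AB0.
- by rewrite -[leRHS]adde0 leeD.
- by rewrite -[leRHS]add0e leeD.
- by rewrite -[leRHS]add0e leeD.
Qed.
End LowerIntegral.

Section FTCLower.
Context {R : realType}.
Notation mu := (@lebesgue_measure R).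

(** The fundamental theorem is applied to the continuous derivative; [h] enters only through
    monotonicity of the lower integral. *)
Lemma ftc_le_compact (phi h : R -> R) (a b : R) : a < b ->
  (forall t, a <= t <= b -> [/\ derivable phi t 1,
     {for t, continuous (derive1 phi)} & `|derive1 phi t| <= h t]) ->
  ((`|phi b - phi a|)%:E <= \int[mu]_(t in `[a, b]) (h t)%:E)%E.
Proof.
move=> ab H.
have cphi : {within `[a, b], continuous phi}.
  apply: derivable_within_continuous => t; rewrite in_itv/= => /H[dphi _ _].
  exact: dphi.
have cdphi : {within `[a, b], continuous (derive1 phi)}.
  apply: continuous_in_subspaceT => t; rewrite inE/= in_itv/=.
  by move=> /H[].
have [_ pa pb] := (continuous_within_itvP phi ab).1 cphi.
have FTC : (\int[mu]_(x in `[a, b]) (derive1 phi x)%:E = (phi b - phi a)%:E)%E.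
  rewrite (@continuous_FTC2 _ _ phi)// ?EFinB//.
  split => // t; rewrite in_itv/= => /andP[ta tb].
  have tab : a <= t <= b by rewrite (ltW ta) (ltW tb).
  have [dphi _ _] := H t tab; exact: dphi.
rewrite -abse_EFin -FTC; apply: le_trans (le_abse_integral _ _ _) _ => //.
  apply/measurable_realfun.measurable_EFinP.
  exact: measurable_realfun.subspace_continuous_measurable_fun.
apply: ge0_le_subset_integral => //= t; rewrite in_itv/= => /H[_ _ dh] //.
by rewrite lee_fin (le_trans _ dh).
Qed.

(** A piecewise curve may have corners at the endpoints, so the open interval is exhausted by
    compact ones and continuity of [phi] gives the limit, first at [b] and then at [a]. *)
Lemma ftc_le (phi h : R -> R) (a b : R) : a < b ->
  {within `[a, b], continuous phi} ->
  (forall t, a < t < b -> [/\ derivable phi t 1,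
     {for t, continuous (derive1 phi)} & `|derive1 phi t| <= h t]) ->
  ((`|phi b - phi a|)%:E <= \int[mu]_(t in `]a, b[) (h t)%:E)%E.
Proof.
move=> ab cphi H.
have h0 t : `]a, b[%classic t -> (0 <= (h t)%:E)%E.
  by rewrite /= in_itv/= lee_fin => /H[_ _]; apply: le_trans.
have := integral_ge0 mu h0.
case E : (\int[mu]_(t in `]a, b[) (h t)%:E)%E => [I| |]// _; last exact: leey.
have [_ pa pb] := (continuous_within_itvP phi ab).1 cphi.
have inner a' b' : a < a' -> a' < b' -> b' < b -> `|phi b' - phi a'| <= I.
  move=> aa' ab' bb'; rewrite -lee_fin -E.
  apply: le_trans (ftc_le_compact ab' _) _ => [t /andP[ta tb]|].
    by apply: H; rewrite (lt_le_trans aa' ta) (le_lt_trans tb bb').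
  apply: ge0_le_subset_integral => // t /=; rewrite !in_itv/= => /andP[ta tb].
    by rewrite (lt_le_trans aa' ta) (le_lt_trans tb bb').
  by apply: h0; rewrite /= in_itv/= (lt_le_trans aa' ta) (le_lt_trans tb bb').
rewrite lee_fin.
have right a' : a < a' -> a' < b -> `|phi b - phi a'| <= I.
  move=> aa' ab'.
  have cv : `|phi t - phi a'| @[t --> b^'-] --> `|phi b - phi a'|.
    by apply: cvg_norm; apply: cvgB => //; exact: cvg_cst.
  apply: cvgr_to_le cv _; near=> t; exact: inner.
have cv : `|phi b - phi t| @[t --> a^'+] --> `|phi b - phi a|.
  by apply: cvg_norm; apply: cvgB => //; exact: cvg_cst.
apply: cvgr_to_le cv _; near=> t; exact: right.
Unshelve. all: by end_near. Qed.

(** Here [e] will be an exit time: it need not be a node, and regularity is asked only before it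
    because the curve may leave the chart afterwards. *)
Lemma ftc_le_piecewise (phi h : R -> R) (s : nat -> R) (k : nat) (e : R) :
  s 0%N <= e <= s k -> {within `[s 0%N, e], continuous phi} ->
  (forall t, 0 <= h t) ->
  (forall j, (j < k)%N -> s j < s j.+1) ->
  (forall j t, (j < k)%N -> s j < t < s j.+1 -> t < e -> [/\ derivable phi t 1,
     {for t, continuous (derive1 phi)} & `|derive1 phi t| <= h t]) ->
  ((`|phi e - phi (s 0%N)|)%:E <= \int[mu]_(t in `[s 0%N, e]) (h t)%:E)%E.
Proof.
move=> /andP[e0 ek] cphi h0 sS H.
have s0 j : (j <= k)%N -> s 0%N <= s j.
  elim: j => // j IH jk; apply: le_trans (IH (ltnW jk)) (ltW (sS _ jk)).
(* Truncation by [Num.min] makes the pieces beyond [e] empty, and half-open intervals keep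
   successive pieces disjoint. *)
suff main j : (j <= k)%N ->
    ((`|phi (Num.min (s j) e) - phi (s 0%N)|)%:E <=
     \int[mu]_(t in `[s 0%N, Num.min (s j) e[) (h t)%:E)%E.
  have := main k (leqnn k); rewrite min_r// => /le_trans; apply.
  apply: ge0_le_subset_integral => //= t; rewrite ?lee_fin//.
  by rewrite /= !in_itv/= => /andP[-> /ltW].
elim: j => [_|j IH jk].
  rewrite min_l// subrr normr0 integral_ge0// => t _; exact: h0.
have [ej|je] := leP e (s j).
  move: (IH (ltnW jk)); rewrite !min_r//.
  by rewrite (le_trans ej)// ltW// sS.
set m := Num.min (s j.+1) e; move: (IH (ltnW jk)); rewrite (min_l (ltW je)) => IHj.
have jm : s j < m by rewrite lt_min sS// je.
have me : m <= e by rewrite ge_min lexx orbT.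
have step : ((`|phi m - phi (s j)|)%:E <=
    \int[mu]_(t in `]s j, m[) (h t)%:E)%E.
  apply: ftc_le => //.
    apply: continuous_subspaceW cphi => t /=; rewrite !in_itv/= => /andP[jt tm].
    by rewrite (le_trans (s0 j (ltnW jk)) jt) (le_trans tm me).
  move=> t /andP[jt]; rewrite lt_min => /andP[tS te].
  by apply: (H j) => //; rewrite jt tS.
have tri : `|phi m - phi (s 0%N)| <=
    `|phi (s j) - phi (s 0%N)| + `|phi m - phi (s j)|.
  have -> : phi m - phi (s 0%N) =
    (phi (s j) - phi (s 0%N)) + (phi m - phi (s j)) by ring.
  exact: ler_normD.
apply: le_trans
  (_ : _ <= (`|phi (s j) - phi (s 0%N)| + `|phi m - phi (s j)|)%:E)%E _.
  by rewrite lee_fin.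
rewrite EFinD; apply: le_trans (leeD IHj step) _.
apply: le_trans (ge0_integral_setU_le _ _ _) _.
- rewrite -subset0 => t []/=; rewrite !in_itv/= => /andP[_ tj] /andP[+ _].
  by rewrite ltNge (ltW tj).
- by move=> t _; rewrite lee_fin.
apply: ge0_le_subset_integral => // t; rewrite ?lee_fin//.
move=> []/=; rewrite !in_itv/= => /andP[t0 tm].
  by rewrite t0 (lt_trans tm).
by rewrite tm andbT (le_trans (s0 j (ltnW jk)))// ltW.
Qed.
End FTCLower.

(** * Curves in charts *)

Section Charts.
Context {R : realType} {n : nat} {M : manifold R n}.
Implicit Types (i j : idx M) (p q : M) (c : R -> M).

Lemma near_dom i p : dom (atlas i) p -> \forall q \near p, dom (atlas i) q.
Proof. by move=> ip; apply: open_nbhs_nbhs; split => //; exact: dom_open. Qed.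

Lemma near_coord_image i (x : 'rV[R]_n) : coord_image i x ->
  \forall y \near x, coord_image i y.
Proof. by move=> ix; apply: open_nbhs_nbhs; split => //; exact: codom_open. Qed.

Lemma param_dom i (x : 'rV[R]_n) : coord_image i x ->
  dom (atlas i) (param (atlas i) x) /\ coord (atlas i) (param (atlas i) x) = x.
Proof. by move=> [p ip <-]; rewrite coordK. Qed.

Lemma transition_Ck1 i j p : dom (atlas i) p -> dom (atlas j) p ->
  let F := transition (atlas i) (atlas j) in
  differentiable F (coord (atlas i) p) /\
  forall v, {for coord (atlas i) p, continuous (fun x => 'D_v F x)}.
Proof.
move=> ip jp F; have [dF cF] := transition_smooth i j 1.
have Fp : (coord (atlas i) @` (dom (atlas i) `&` dom (atlas j)))
  (coord (atlas i) p) by exists p.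
by split=> [|v]; [exact: dF | exact: cF].
Qed.

Lemma coord_transition_near i j c (s : R) : {for s, continuous c} ->
  dom (atlas i) (c s) ->
  \forall t \near s, (coord (atlas j) \o c) t =
    (transition (atlas i) (atlas j) \o (coord (atlas i) \o c)) t.
Proof.
move=> cs /near_dom/cs ics.
have {}ics : \forall t \near s, dom (atlas i) (c t) by exact: ics.
apply: filterS ics => t /= it.
by rewrite /transition/= coordK.
Qed.

Lemma derive_transition i j (u : R -> 'rV[R]_n) (s v : R) p :
  dom (atlas i) p -> dom (atlas j) p -> u s = coord (atlas i) p ->
  derivable u s 1 ->
  let F := transition (atlas i) (atlas j) in
  differentiable (F \o u : R^o -> 'rV[R]_n) s /\
  'D_v (F \o u : R^o -> 'rV[R]_n) s = 'D_('D_v (u : R^o -> 'rV[R]_n) s) F (u s).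
Proof.
move=> ip jp us /derivable1_diffP du F.
have [dF _] := transition_Ck1 ip jp.
have dFu : differentiable F (u s) by rewrite us.
have dc := differentiable_comp du dFu.
split; first exact: dc.
by rewrite (deriveE _ dc) (diff_comp du dFu) (deriveE _ dFu) (deriveE _ du).
Qed.

(** [speed] evaluates in [chart_at (c s)], which may jump with [s]; the Jacobian from the chain rule
    is absorbed by [metric_change], so one fixed chart can be used. *)
Lemma speed_chart (g : tensor2 M) c (s : R) i : riemannian_metric g ->
  {for s, continuous c} -> dom (atlas i) (c s) ->
  derivable (coord (atlas i) \o c) s 1 ->
  speed g c s = Num.sqrt (qform (g i (coord (atlas i) (c s)))
                               (derive1 (coord (atlas i) \o c) s)).
Proof.
move=> mg cs ics du; rewrite /speed.
set j := chart_at (c s).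
have jcs : dom (atlas j) (c s) by exact: chart_at_dom.
have [dF _] := transition_Ck1 ics jcs.
have [dc Dc] := derive_transition 1 ics jcs erefl du.
apply: (congr1 Num.sqrt).
rewrite derive1E (near_eq_derive _ (coord_transition_near j cs ics)).
rewrite Dc deriveEjacobian//= -derive1E (metric_change mg ics jcs) /qform.
by rewrite trmx_mul !mulmxA.
Qed.

End Charts.

Section StraightLine.
Context {R : realType} {n : nat} {M : manifold R n}.
Variables (i : idx M) (x0 w : 'rV[R]_n).

Let line (s : R) : 'rV[R]_n := x0 + s *: w.
Let c (s : R) : M := param (atlas i) (line s).

Lemma is_derive_line (s v : R) : is_derive s v line (v *: w).
Proof.
have H : is_derive s v (fun s : R => s *: w) (v *: w).
  have D : is_diff s (fun s : R^o => s *: w) (fun s => s *: w).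
    exact: is_diff_scalel.
  have dD : differentiable (fun s : R^o => s *: w) s by exact: ex_diff.
  by split; [exact: diff_derivable | rewrite deriveE// diff_val].
have := is_deriveD (is_derive_cst x0 s v) H.
by rewrite add0r.
Qed.

Lemma line_cont (s : R) : {for s, continuous line}.
Proof.
apply: differentiable_continuous; apply/derivable1_diffP.
by apply: ex_derive; exact: is_derive_line.
Qed.

Lemma line_curve_cont (s : R) : coord_image i (line s) -> {for s, continuous c}.
Proof.
move=> ils; apply: (@continuous_comp _ _ _ line (param (atlas i))).
  exact: line_cont.
exact: param_cont.
Qed.

Lemma line_curve_coord (s : R) : coord_image i (line s) ->
  \forall t \near s, coord_image i (line t) /\ (coord (atlas i) \o c) t = line t.
Proof.
move=> /near_coord_image ils.
have {}ils : \forall t \near s, coord_image i (line t) by exact: (line_cont ils).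
by apply: filterS ils => t ilt; split => //=; have [] := param_dom ilt.
Qed.

Lemma line_curve_speed (g : tensor2 M) (s : R) : riemannian_metric g ->
  coord_image i (line s) -> speed g c s = Num.sqrt (qform (g i (line s)) w).
Proof.
move=> mg ils; have [ids cs] := param_dom ils.
have near_line : \near s, line s = (coord (atlas i) \o c) s.
  by apply: filterS (line_curve_coord ils) => t [].
have dl : is_derive s 1 (coord (atlas i) \o c) w.
  apply: (near_eq_is_derive near_line).
  by rewrite -[w in is_derive _ _ _ w]scale1r; exact: is_derive_line.
rewrite (speed_chart mg (line_curve_cont ils) ids); last exact: ex_derive.
by rewrite cs derive1E derive_val.
Qed.

(** A single piece suffices. Since every chart [j] has to be tested, the segment is read there as a
    transition map along [line], whose derivative in direction [v] is the continuous ['D_(v *: w) F]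
    along the line. *)
Lemma line_curve_piecewise_C1 :
  (forall s, 0 <= s <= 1 -> coord_image i (line s)) -> piecewise_C1 c.
Proof.
move=> il; split.
  apply: continuous_in_subspaceT => s; rewrite inE/= in_itv/= => /il.
  exact: line_curve_cont.
exists 1%N, (fun j => j%:R); split => // -[|//] _; split; first exact: ltr01.
move=> j a [/=]; rewrite in_itv/= => /il ia ja.
pose U := [set t : R^o | coord_image i (line t) /\ dom (atlas j) (c t)].
pose F := transition (atlas i) (atlas j).
have Unear t : U t -> \forall t' \near t, U t'.
  move=> [it jt]; apply: filterS2 (line_curve_coord it)
    (line_curve_cont it (near_dom jt)) => t' [it' _] jt'.
  by split.
have Upt t : U t -> [/\ dom (atlas i) (c t), dom (atlas j) (c t) &
    line t = coord (atlas i) (c t)].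
  by move=> [/param_dom[? ?] ?]; split.
have hnear t : U t -> \forall t' \near t,
    (F \o line) t' = (coord (atlas j) \o c) t'.
  move=> /Unear; apply: filterS => t' /Upt[it' _ e].
  by rewrite /F /transition/= e coordK.
have dF t v : U t -> differentiable (coord (atlas j) \o c : R^o -> _) t /\
    'D_v (coord (atlas j) \o c : R^o -> _) t = 'D_(v *: w) F (line t).
  move=> Ut; have [it jt e] := Upt t Ut.
  have dl := is_derive_line t 1.
  have [dl' Dl] := derive_transition v it jt e (@ex_derive _ _ _ _ _ _ _ dl).
  rewrite (@derive_val _ _ _ _ _ _ _ (is_derive_line t v)) in Dl.
  split.
    apply/derivable1_diffP; apply: near_eq_derivable (hnear t Ut) _.
    exact/derivable1_diffP.
  by rewrite -Dl; apply: near_eq_derive; apply: filterS (hnear t Ut).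
exists U, (coord (atlas j) \o c); split => //.
split => [t Ut|v t Ut]; first by have [] := dF t 0 Ut.
  have nD : \forall t' \near t,
      'D_(v *: w) F (line t') = 'D_v (coord (atlas j) \o c : R^o -> _) t'.
    by apply: filterS (Unear t Ut) => t' Ut'; have [_ ->] := dF t' v Ut'.
  have [it jt e] := Upt t Ut.
  have [_ /(_ (v *: w)) cF] := transition_Ck1 it jt.
  rewrite -/F -e in cF.
  have cc : {for t, continuous (fun t => 'D_(v *: w) F (line t))}.
    by apply: (@continuous_comp _ _ _ line ('D_(v *: w) F)) => //; exact: line_cont.
  rewrite /prop_for /continuous_at -(nbhs_singleton nD).
  exact: cvg_trans (near_eq_cvg nD) cc.
Qed.

End StraightLine.

Lemma nbhs_metric_ball (R : realType) (n : nat) (M : manifold R n)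
    (g : tensor2 M) (p : M) (r : R) : riemannian_metric g -> 0 < r ->
  nbhs p (metric_ball g p r).
Proof.
move=> mg r0; pose i := chart_at p; pose x0 := coord (atlas i) p.
have ip : dom (atlas i) p by exact: chart_at_dom.
have ix0 : coord_image i x0 by exists p.
have cg a b : {for x0, continuous (fun x => g i x a b)}.
  exact: (metric_smooth mg i a b 0%N).
have [C C0 qC] := qform_bounded_near cg.
have near_x0 : \forall x \near x0, coord_image i x /\
    forall v, qform (g i x) v <= C * `|v| ^+ 2.
  by apply: filterS2 (near_coord_image ix0) qC.
have [d /= d0 dball] := (nbhs_normP _ _).1 near_x0.
(* The first bound keeps the segment where the chart and the estimate by [C] are valid; the second
   makes its length less than [r]. *)
pose e := Num.min d (r / (Num.sqrt C + 1)).
have e0 : 0 < e by rewrite lt_min d0 divr_gt0// ltr_wpDl// sqrtr_ge0.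
have ccp : {for p, continuous (coord (atlas i))} by exact: coord_cont.
have /cvgrPdist_lt/(_ e e0) near_p := ccp.
apply: filterS2 (near_dom ip) near_p => q iq qe.
pose w := coord (atlas i) q - x0.
have we : `|w| < e by rewrite /w distrC.
have wd s : 0 <= s <= 1 -> coord_image i (x0 + s *: w) /\
    forall v, qform (g i (x0 + s *: w)) v <= C * `|v| ^+ 2.
  move=> /andP[s0 s1]; apply: dball => /=.
  rewrite opprD addrA subrr add0r normrN normrZ ger0_norm//.
  apply: le_lt_trans (_ : `|w| < d); first by rewrite ler_piMl.
  by rewrite (lt_le_trans we)// ge_min lexx.
pose c s := param (atlas i) (x0 + s *: w).
rewrite /metric_ball/=; apply: (@le_lt_trans _ _ (curve_length g c)).
  apply: ereal_inf_lbound; exists c => //; split.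
  - by apply: line_curve_piecewise_C1 => s /wd[].
  - by rewrite /c scale0r addr0 coordK.
  - by rewrite /c scale1r /w addrC subrK coordK.
apply: (@le_lt_trans _ _ ((Num.sqrt C * `|w|)%:E)).
  apply: (@le_trans _ _ (\int[lebesgue_measure]_(s in `[0%R, 1%R])
      (cst (Num.sqrt C * `|w|)%:E s))%E); last first.
    rewrite integral_cst//= lebesgue_measure_itv/= lte01 oppr0 adde0 mule1//.
  apply: ge0_le_subset_integral => //= s.
  - by rewrite lee_fin sqrtr_ge0.
  - rewrite in_itv/= => /wd[ils qs]; rewrite lee_fin line_curve_speed//.
    rewrite -[`|w| in leRHS]ger0_norm// -sqrtr_sqr -sqrtrM ?(ltW C0)//.
    exact: ler_wsqrtr.
rewrite lte_fin; have C1 : 0 < Num.sqrt C + 1 by rewrite ltr_wpDl ?sqrtr_ge0.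
apply: (@le_lt_trans _ _ ((Num.sqrt C + 1) * `|w|)).
  by rewrite ler_wpM2r// lerDl.
by rewrite mulrC -ltr_pdivlMr// (lt_le_trans we)// ge_min lexx orbT.
Qed.

(** * First exit of a curve from a coordinate ball *)

Lemma norm_sub_continuous (R : realType) (V : normedModType R) (x0 : V) :
  continuous (fun x => `|x - x0|).
Proof.
move=> x; apply: cvg_norm; apply: cvgB; first exact: cvg_id.
exact: cvg_cst.
Qed.

Lemma within_near (R : realType) (T : topologicalType) (c : R -> T)
    (s : R) (A : set T) :
  {within `[0, 1], continuous c} -> 0 <= s <= 1 -> nbhs (c s) A ->
  exists2 d, 0 < d & forall t, 0 <= t <= 1 -> `|s - t| < d -> A (c t).
Proof.
move=> /subspace_continuousP cc s01 cA.
have /cc/(_ _ cA) : `[0, 1]%classic s by rewrite /= in_itv.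
move=> /nbhs_normP[d /= d0 dA]; exists d => // t t01 std.
by apply: dA => //; rewrite /= in_itv.
Qed.

Section Exit.
Context {R : realType} {n : nat} {M : manifold R n}.
Variables (g : tensor2 M) (i : idx M) (p : M) (rho kappa : R).
Let x0 := coord (atlas i) p.
Hypotheses (mg : riemannian_metric g) (ip : dom (atlas i) p).
Hypotheses (rho0 : 0 < rho) (kappa0 : 0 < kappa).
Hypothesis chart_ball : forall x, `|x - x0| <= rho -> coord_image i x.
Hypothesis coercive : forall x, `|x - x0| <= rho ->
  forall v, kappa ^+ 2 * `|v| ^+ 2 <= qform (g i x) v.

Let W : set M :=
  [set q | dom (atlas i) q /\ `|coord (atlas i) q - x0| < rho].
Let K : set M :=
  [set q | dom (atlas i) q /\ `|coord (atlas i) q - x0| <= rho].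

Lemma chart_ball_near q : W q -> \forall q' \near q, W q'.
Proof.
move=> [iq qr].
have cc : {for q, continuous (fun q => `|coord (atlas i) q - x0|)}.
  apply: (@continuous_comp _ _ _ (coord (atlas i)) (fun x => `|x - x0|)).
    exact: coord_cont.
  exact: norm_sub_continuous.
have near_r : \forall q' \near q, `|coord (atlas i) q' - x0| < rho.
  exact: (cvgr_lt _ cc).
by apply: filterS2 (near_dom iq) near_r.
Qed.

(** A compact image in a Hausdorff space. Closedness in the whole of [M] is what prevents a curve
    from leaving the chart without meeting the coordinate sphere. *)
Lemma chart_closed_ball_closed : closed K.
Proof.
apply: compact_closed; first exact: space_hausdorff.
have -> : K = param (atlas i) @` [set x | `|x - x0| <= rho].
  rewrite eqEsubset; split=> [q [iq qr]|_ [x /= xr <-]].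
    by exists (coord (atlas i) q) => //; rewrite coordK.
  have [ix cx] := param_dom (chart_ball xr).
  by split => //; rewrite cx.
apply: continuous_compact.
  apply: continuous_in_subspaceT => x /set_mem/= /chart_ball ix.
  exact: param_cont.
apply: bounded_closed_compact.
  exists (`|x0| + rho); split; first exact: num_real.
  move=> y hy x /= xr; apply: le_trans (ltW hy).
  by rewrite -[x](subrK x0) (le_trans (ler_normD _ _))// addrC lerD2l.
rewrite -[X in closed X]/((fun x : 'rV[R]_n => `|x - x0|) @^-1` [set y | y <= rho]).
apply: closed_comp; last exact: closed_le.
by move=> x _; exact: norm_sub_continuous.
Qed.

Lemma exit_time (c : R -> M) : {within `[0, 1], continuous c} ->
  c 0 = p -> ~ W (c 1) ->
  exists e, [/\ 0 < e <= 1, forall s, 0 <= s < e -> W (c s),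
    dom (atlas i) (c e) & `|coord (atlas i) (c e) - x0| = rho].
Proof.
move=> cc c0 c1.
pose B := [set s : R | 0 <= s <= 1 /\ ~ W (c s)].
have B1 : B 1 by split => //; rewrite ler01 lexx.
have lB : lbound B 0 by move=> s [/andP[]].
have hB : has_inf B by split; [exists 1 | exists 0].
(* The first exit time. As [W] is open, [c e] is outside [W]; as [K] is closed and contains the
   earlier points, [c e] is in [K]; hence it lies on the sphere. *)
pose e := inf B.
have e0 : 0 <= e by apply: lb_le_inf => //; exists 1.
have e1 : e <= 1 by apply: ge_inf => //; exists 0.
have e01 : 0 <= e <= 1 by rewrite e0.
have before s : 0 <= s < e -> W (c s).
  move=> /andP[s0 se]; apply: contrapT => nW.
  have : e <= s.
    apply: ge_inf; first by exists 0.
    by split => //; rewrite s0 (le_trans (ltW se)).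
  by rewrite leNgt se.
have nWe : ~ W (c e).
  move=> /chart_ball_near We.
  have [d d0 dW] := within_near cc e01 We.
  have [s [s01 nWs] sd] := inf_adherent d0 hB.
  have es : e <= s by apply: ge_inf => //; exists 0.
  by apply/nWs/dW => //; rewrite distrC ger0_norm ?subr_ge0// ltrBlDl.
have W0 : W (c 0) by rewrite c0; split => //; rewrite subrr normr0.
have e_gt0 : 0 < e.
  rewrite lt0r e0 andbT; apply/eqP => e00; apply: nWe; rewrite e00; exact: W0.
have Ke : K (c e).
  apply: contrapT => nK.
  have oK : nbhs (c e) (~` K).
    apply: open_nbhs_nbhs; split => //; rewrite openC.
    exact: chart_closed_ball_closed.
  have [d d0 dK] := within_near cc e01 oK.
  pose s := Num.max 0 (e - d / 2).
  have se : s < e by rewrite gt_max e_gt0 gtrBl divr_gt0.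
  have s0 : 0 <= s by rewrite le_max lexx.
  apply: (dK s); first by rewrite s0 (le_trans (ltW se)).
    rewrite gtr0_norm ?subr_gt0//.
    have : e - d / 2 <= s by rewrite le_max lexx orbT.
    lra.
  by have [|? /ltW] := before s; [rewrite s0|].
have [ie re] := Ke.
exists e; split => //; first by rewrite e_gt0.
by apply/eqP; rewrite eq_le re leNgt; apply/negP => ?; exact: nWe.
Qed.

(** The norm of a row vector is its largest absolute coordinate, so it suffices to bound the
    increment of each coordinate. Multiplied by [kappa], a coordinate has derivative at most the
    speed, by coercivity inside the ball. *)
Lemma exit_length (c : R -> M) : piecewise_C1 c -> c 0 = p -> ~ W (c 1) ->
  ((kappa * rho)%:E <= curve_length g c)%E.
Proof.
move=> [cc [k [s [s0 sk reg]]]] c0 c1.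
have [e [/andP[e0 e1] before ie re]] := exit_time cc c0 c1.
have sg0 t : 0 <= speed g c t by exact: sqrtr_ge0.
have : (0 <= curve_length g c)%E.
  by apply: integral_ge0 => t _; rewrite lee_fin.
case L : (curve_length g c) => [l| |]// l0; last exact: leey.
pose u := coord (atlas i) \o c.
have domc t : 0 <= t <= e -> dom (atlas i) (c t).
  move=> /andP[t0]; rewrite le_eqVlt => /predU1P[-> //|te].
  by have [|] := before t; rewrite ?t0.
have c_cont t : 0 < t < 1 -> {for t, continuous c}.
  move=> t01.
  have coo : {within `]0, 1[, continuous c}.
    by apply: continuous_subspaceW cc; exact: subset_itv_oo_cc.
  move: coo; rewrite continuous_open_subspace; last exact: interval_open.
  by apply; rewrite inE/= in_itv.
(* Strictly between two nodes the local extension agrees with [u] on a full neighbourhood, so its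
   derivatives are those of [u]. *)
have u_reg j t : (j < k)%N -> s j < t < s j.+1 -> 0 < t < e ->
    derivable u t 1 /\ {for t, continuous (derive1 u)}.
  move=> jk /andP[st ts] /andP[t0 te].
  have cont : {for t, continuous c}.
        by apply: c_cont; rewrite t0 (lt_le_trans te).
  have it : dom (atlas i) (c t) by apply: domc; rewrite (ltW t0) (ltW te).
  have [_ /(_ i) ext] := reg j jk.
  have [|U [h [oU Ut [dh ch] hE]]] := ext t.
    by split => //=; rewrite in_itv/= (ltW st) (ltW ts).
  have nU : \forall t' \near t, U t' by exact: open_nbhs_nbhs.
  have nd : \forall t' \near t, dom (atlas i) (c t').
    exact: (cont _ (near_dom it)).
  have nhu : \forall t' \near t, h t' = u t'.
    near=> t'; apply: hE; first by near: t'.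
    split; last by near: t'.
    rewrite /= in_itv/=; apply/andP; split; apply: ltW; near: t'.
      exact: lt_nbhsr.
    exact: lt_nbhsl.
  split.
    by apply: near_eq_derivable nhu _; apply: diff_derivable; exact: dh.
  have nD : \forall t' \near t, 'D_1 h t' = derive1 u t'.
    apply: filterS (nbhs_interior nhu) => t' hu.
    by rewrite derive1E; exact: near_eq_derive.
  rewrite /prop_for /continuous_at -(nbhs_singleton nD).
  exact: cvg_trans (near_eq_cvg nD) (ch 1 t Ut).
have s_ge0 j : (j <= k)%N -> 0 <= s j.
  elim: j => [|j IH jk]; first by rewrite s0.
  by apply: le_trans (IH (ltnW jk)) (ltW (reg j jk).1).
have key a : `|kappa * u e 0 a - kappa * u 0 0 a| <= l.
  pose phi t := kappa * u t 0 a.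
  have phi_reg j t : (j < k)%N -> s j < t < s j.+1 -> t < e ->
      [/\ derivable phi t 1, {for t, continuous (derive1 phi)} &
          `|derive1 phi t| <= speed g c t].
    move=> jk /andP[st ts] te.
    have t0 : 0 < t by rewrite (le_lt_trans (s_ge0 j (ltnW jk))).
    have [||du cdu] := u_reg j t jk; [by rewrite st|by rewrite t0|].
    have Dphi t' : derivable u t' 1 ->
        derivable phi t' 1 /\ derive1 phi t' = kappa * derive1 u t' 0 a.
      move=> du'; have /(_ 0 a) dua := (derivable_mxP _ _ _).1 du'.
      have dcst : derivable (cst kappa : R -> R) t' 1 by exact: derivable_cst.
      split; first exact: (derivableM dcst dua).
      rewrite derive1E (deriveM dcst dua) derive_cst scaler0 addr0 derive1E.
      by rewrite (derive_mx du') mxE.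
    split; first by have [] := Dphi t du.
    - have nD : \forall t' \near t, kappa * derive1 u t' 0 a = derive1 phi t'.
        near=> t'; have [|_ ->//] := Dphi t'.
        by have [||//] := u_reg j t' jk; apply/andP; split; near: t';
          solve [exact: lt_nbhsr | exact: lt_nbhsl].
      rewrite /prop_for /continuous_at -(nbhs_singleton nD).
      apply: cvg_trans (near_eq_cvg nD) _.
      apply: cvgMr.
      apply: (@continuous_comp _ _ _ (derive1 u) (fun v => v 0 a)) => //.
      exact: coord_continuous.
    - have [_ ->] := Dphi t du.
      have it : dom (atlas i) (c t) by apply: domc; rewrite (ltW t0) (ltW te).
      have cont : {for t, continuous c}.
        by apply: c_cont; rewrite t0 (lt_le_trans te).
      rewrite (speed_chart mg cont it du).
      have Wt : W (c t) by apply: before; rewrite ltW.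
      have := coercive (ltW Wt.2) (derive1 u t); rewrite -exprMn => qu.
      apply: le_trans (ler_wsqrtr qu); rewrite sqrtr_sqr !normrM normr_id.
      by rewrite ler_wpM2l// coord_le_norm.
  rewrite -lee_fin -L.
  have E0 : s 0%N <= e <= s k by rewrite s0 sk e1 ltW.
  have cphi : {within `[s 0%N, e], continuous phi}.
    have ce : {within `[s 0%N, e], continuous c}.
      apply: continuous_subspaceW cc => t /=; rewrite !in_itv/= s0.
      by move=> /andP[-> te]; rewrite (le_trans te).
    apply/subspace_continuousP => t te.
    have it : dom (atlas i) (c t) by apply: domc; move: te; rewrite /= in_itv/= s0.
    have {}ce := (subspace_continuousP _ _).1 ce t te.
    have cu : u @ within `[s 0%N, e] (nbhs t) --> u t.
      exact: cvg_comp ce (coord_cont it).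
    apply: cvgMr; apply: (cvg_comp _ (fun v => v 0 a) cu).
    exact: coord_continuous.
  have := ftc_le_piecewise E0 cphi sg0 (fun j jk => (reg j jk).1) phi_reg.
  rewrite s0 => /le_trans; apply.
  apply: ge0_le_subset_integral => t; rewrite ?lee_fin//.
  by rewrite /= !in_itv/= => /andP[-> te]; rewrite (le_trans te).
have u0 : u 0 = x0 by rewrite /u/= c0.
rewrite lee_fin -re mulrC -ler_pdivlMr//.
apply: norm_row_le => [|a]; first by rewrite divr_ge0// ltW.
rewrite -u0 ler_pdivlMr// mulrC -[kappa in leLHS]gtr0_norm// -normrM !mxE.
by rewrite mulrBr.
Unshelve. all: by end_near. Qed.
End Exit.

(** * Ricci flow *)

Section Flow.
Context {R : realType} {n : nat} {M : manifold R n}.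
Variables (T : R) (g : R -> tensor2 M).
Hypothesis hg : ricci_flow T g.

Lemma pos_def_metric (h : tensor2 M) i x : riemannian_metric h ->
  coord_image i x -> pos_def (h i x).
Proof. by move=> mh ix; split; [exact: metric_sym | exact: metric_pos]. Qed.

(** At positive times [0,T) is a neighbourhood of [t], so the limit restricted to it is an ordinary
    derivative. *)
Lemma is_derive_flow (t : R) i x a b : 0 < t < T -> coord_image i x ->
  is_derive t 1 (fun s => g s i x a b : R^o) (- 2 * ricci (g t i) a b x).
Proof.
move=> /andP[t0 tT] ix; set l := - 2 * _.
have t0T : 0 <= t < T by rewrite ltW.
have /cvgrPdist_lt flow := @flow_eq _ _ _ _ _ hg t t0T i x ix a b.
suff cv : h^-1 *: ((fun s => g s i x a b : R^o) (h *: 1 + t) - g t i x a b)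
    @[h --> 0^'] --> (l : R^o).
  by split; [apply/cvg_ex; exists l | apply: cvg_lim].
apply/cvgrPdist_lt => e e0.
have near_t : \forall s \near t, 0 <= s < T.
  near=> s; apply/andP; split; last by near: s; exact: lt_nbhsl.
  by apply: ltW; near: s; exact: lt_nbhsr.
have near_flow : \forall s \near t, 0 <= s < T /\ (s != t -> 0 <= s < T ->
    `|l - (s - t)^-1 * (g s i x a b - g t i x a b)| < e).
  have {}flow : \forall s \near t, s != t -> 0 <= s < T ->
    `|l - (s - t)^-1 * (g s i x a b - g t i x a b)| < e by exact: (flow e e0).
  by apply: filterS2 near_t flow.
have [d /= d0 fd] := (nbhs_normP _ _).1 near_flow.
near=> h.
have h0 : h != 0 by near: h; exact: nbhs_dnbhs_neq.
have [] := fd (h *: 1 + t).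
  rewrite /ball_/= opprD addrCA subrr addr0 normrN /GRing.scale/= mulr1.
  by near: h; exact: dnbhs0_lt.
move=> ht /(_ _ ht); rewrite addrK /GRing.scale/= mulr1; apply.
by rewrite -subr_eq0 addrK.
Unshelve. all: by end_near. Qed.

(** The 2 comes from the flow equation and n^3 from [trace_form_le]. The exponent contains [T - tau]
    in place of [t - tau] to be uniform in [t]. *)
Lemma metric_growth (tau t K : R) i x (v : 'rV[R]_n) : 0 < tau -> tau <= t < T ->
  coord_image i x ->
  (forall s, tau <= s < T -> riem_norm (g s i) x <= K) ->
  expR (- (2 * n%:R ^+ 3 * K) * (T - tau)) * qform (g tau i x) v <=
  qform (g t i x) v.
Proof.
move=> tau0 /andP[taut tT] ix RmK.
have flow_pos s : tau <= s < T -> pos_def (g s i x).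
  move=> /andP[ts sT]; apply: pos_def_metric => //; apply: flow_metric hg _ _.
  by rewrite sT (le_trans (ltW tau0)).
have q0 s : tau <= s < T -> 0 <= qform (g s i x) v.
  move=> /flow_pos[_ ps]; have [->|/ps/ltW//] := eqVneq v 0.
  by rewrite /qform !mul0mx mxE.
have tauT : tau <= tau < T by rewrite lexx (le_lt_trans taut).
have K0 : 0 <= K by apply: le_trans (RmK tau tauT); exact: sqrtr_ge0.
have k0 : 0 <= 2 * n%:R ^+ 3 * K by rewrite !mulr_ge0 ?exprn_ge0.
set k := 2 * n%:R ^+ 3 * K.
apply: (@le_trans _ _ (expR (- k * (t - tau)) * qform (g tau i x) v)).
  rewrite ler_wpM2r ?q0// ler_expR !mulNr lerN2 ler_wpM2l//.
  by rewrite lerB// ltW.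
pose f s := qform (g s i x) v.
apply: (@gronwall_lower _ f) => // s /andP[ts st].
have sT : s < T by rewrite (le_lt_trans st).
have tsT : tau <= s < T by rewrite ts.
have df : is_derive s 1 f
    (- 2 * \sum_a \sum_b v 0 a * v 0 b * ricci (g s i) a b x).
  have -> : f = \sum_a \sum_b (fun s => v 0 a * v 0 b * g s i x a b).
    apply/funext => r; rewrite /f qformE fct_sumE; apply: eq_bigr => a _.
    by rewrite fct_sumE.
  have s0T : 0 < s < T by rewrite sT (lt_le_trans tau0).
  have -> : - 2 * \sum_a \sum_b v 0 a * v 0 b * ricci (g s i) a b x =
      \sum_a \sum_b v 0 a * v 0 b * (- 2 * ricci (g s i) a b x).
    rewrite mulr_sumr; apply: eq_bigr => a _; rewrite mulr_sumr.
    by apply: eq_bigr => b _; ring.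
  apply: is_derive_sum => a; apply: is_derive_sum => b.
  exact: (is_deriveZ (v 0 a * v 0 b) (is_derive_flow a b s0T ix)).
split; first exact: ex_derive.
rewrite derive1E derive_val.
have := trace_form_le (fun a b c d => riem (g s i) a b c d x) v (flow_pos s tsT).
rewrite -/(riem_norm (g s i) x) => /ler_normlP[_].
pose A := \sum_a \sum_b v 0 a * v 0 b * ricci (g s i) a b x.
rewrite -/A -/(f s) => trA.
have : A <= n%:R ^+ 3 * K * f s.
  apply: le_trans trA _.
  by rewrite ler_wpM2r ?q0// ler_wpM2l ?exprn_ge0 ?RmK.
rewrite /k; lra.
Qed.

Lemma metric_ball_sub p (U : set M) (tau K : R) : nbhs p U -> 0 <= tau < T ->
  Rm_le g (U `*` `[tau, T[) K ->
  exists2 r : R, 0 < r & exists2 tau1, tau < tau1 < T &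
    forall t, tau1 <= t < T -> metric_ball (g t) p r `<=` U.
Proof.
move=> pU /andP[tau0 tauT] RmK.
(* Positive even when [tau = 0], so that two-sided time derivatives are available from [tau1] on. *)
pose tau1 := (tau + T) / 2.
have tau_lt : tau < tau1 by rewrite midf_lt.
have tau1T : tau1 < T by rewrite midf_lt.
have tau1_gt0 : 0 < tau1 by rewrite (le_lt_trans tau0).
pose i := chart_at p; pose x0 := coord (atlas i) p.
have ip : dom (atlas i) p by exact: chart_at_dom.
have ix0 : coord_image i x0 by exists p.
have m1 : riemannian_metric (g tau1).
  by apply: flow_metric hg _ _; rewrite ltW.
have cg a b : {for x0, continuous (fun x => g tau1 i x a b)}.
  exact: (metric_smooth m1 i a b 0%N).
have [c c0 qc] := pos_def_coercive_near (pos_def_metric m1 ix0) cg.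
have Ux0 : \forall x \near x0, U (param (atlas i) x).
  by apply: (param_cont ix0); rewrite coordK.
have near_x0 : \forall x \near x0, [/\ coord_image i x, U (param (atlas i) x) &
    forall v, c * `|v| ^+ 2 <= qform (g tau1 i x) v].
  by apply: filterS3 (near_coord_image ix0) Ux0 qc.
have [d /= d0 dball] := (nbhs_normP _ _).1 near_x0.
(* Half of [d], so that the closed ball of radius [rho] lies in the open ball of radius [d]. *)
pose rho := d / 2; have rho0 : 0 < rho by rewrite divr_gt0.
have in_ball x : `|x - x0| <= rho -> [/\ coord_image i x, U (param (atlas i) x) &
    forall v, c * `|v| ^+ 2 <= qform (g tau1 i x) v].
  move=> xr; apply: dball; rewrite /ball_/= distrC (le_lt_trans xr)//.
  by rewrite /rho; lra.
(* The Gronwall factor over all of [tau1,T): [c * E] is a coercivity constant for every [g t]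
   there. *)
pose E := expR (- (2 * n%:R ^+ 3 * K) * (T - tau1)).
have cE0 : 0 < c * E by rewrite mulr_gt0// expR_gt0.
pose kappa := Num.sqrt (c * E).
have kappa0 : 0 < kappa by rewrite sqrtr_gt0.
exists (kappa * rho); first by rewrite mulr_gt0.
exists tau1 => [|t /andP[tau1t tT] q]; first by rewrite tau_lt.
rewrite /metric_ball/= => /ereal_inf_lt[_ [c' [c'C1 c'0 c'1] <-]] lc.
have mt : riemannian_metric (g t).
  by apply: flow_metric hg _ _; rewrite tT (le_trans (ltW tau1_gt0)).
apply: contrapT => nUq.
suff : ((kappa * rho)%:E <= curve_length (g t) c')%E by rewrite leNgt lc.
apply: (exit_length mt ip rho0 kappa0) => //.
- by move=> x /in_ball[].
- move=> x /in_ball[ix Ux qx] v; rewrite sqr_sqrtr ?(ltW cE0)//.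
  apply: le_trans (metric_growth (tau := tau1) (K := K) v _ _ ix _) => //.
  + by rewrite -/E mulrAC [leRHS]mulrC ler_wpM2r ?expR_ge0.
  + by rewrite tau1t.
  + move=> s /andP[s1 sT]; have [dx cx] := param_dom ix.
    rewrite -cx; apply: RmK => //; split => //=.
    by rewrite in_itv/= sT (le_trans (ltW tau_lt)).
- rewrite c'1 => -[iq /ltW /in_ball[_ + _]].
  by rewrite coordK.
Qed.
End Flow.

(** * The Riemann scale compared with the remaining time *)

Lemma lt_inve_sqr (R : realType) (d : R) (x : \bar R) : 0 < d -> (0 <= x)%E ->
  ((d^-1)%:E < (x ^+ 2)^-1)%E = (x < (Num.sqrt d)%:E)%E.
Proof.
move=> d0; have s0 : 0 < Num.sqrt d by rewrite sqrtr_gt0.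
(* The conventions agree with the intended meaning: a scale 0 has inverse [+oo] and satisfies the
   inequality, a scale [+oo] has inverse 0 and violates it. *)
case: x => [r| |]//; rewrite ?lee_fin => r0.
- rewrite -EFin_expe inver sqrf_eq0 lte_fin.
  have [->|rn0] := eqVneq r 0; first by rewrite ltry s0.
  have r_gt0 : 0 < r by rewrite lt0r rn0.
  rewrite lte_fin ltf_pV2 ?posrE ?exprn_gt0//.
  by rewrite -{1}[d]sqr_sqrtr ?(ltW d0)// ltr_sqr ?nnegrE// ltW.
- rewrite expe2 mulyy invey lte_fin invr_lt0 ltNge (ltW d0)/=.
  by rewrite ltNge leey.
Qed.

Lemma riemann_scale_ge0 (R : realType) (n : nat) (M : manifold R n) (T : R)
    (g : R -> tensor2 M) p t : (0 <= riemann_scale T g p t)%E.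
Proof. by rewrite /riemann_scale; case: ifP => // _; rewrite le_max lexx. Qed.

Lemma flat_riem_norm (R : realType) (n : nat) (M : manifold R n)
    (h : tensor2 M) i x : flat h -> coord_image i x -> riem_norm (h i) x = 0.
Proof.
move=> fh ix; rewrite /riem_norm.
do 8 (rewrite big1 ?sqrtr0// => ? _).
by rewrite fh// mulr0 mul0r.
Qed.

(* The supremum need not be attained: a curvature value above 1/(T - t) would
   already be excluded by a radius slightly below sqrt (T - t). *)
Lemma riem_norm_le_scale (R : realType) (n : nat) (M : manifold R n) (T : R)
    (g : R -> tensor2 M) p t q s i : 0 <= t < T ->
  ((Num.sqrt (T - t))%:E <= riemann_scale T g p t)%E ->
  metric_ball (g t) p (Num.sqrt (T - t)) q -> t < s < T -> dom (atlas i) q ->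
  riem_norm (g s i) (coord (atlas i) q) <= (T - t)^-1.
Proof.
move=> /andP[t0 tT] scale pq /andP[ts sT] iq.
have d0 : 0 < T - t by rewrite subr_gt0.
move: scale; rewrite /riemann_scale; case: asboolP => [fl _|_].
  rewrite flat_riem_norm ?invr_ge0 ?(ltW d0)//; last by exists q.
  by apply: fl; rewrite sT (le_trans t0 (ltW ts)).
set r0 := Num.sqrt (T - t) in pq *.
have r00 : 0 < r0 by rewrite sqrtr_gt0.
have r0N : (r0%:E <= 0)%E = false by apply/negbTE; rewrite -ltNge lte_fin.
rewrite le_max r0N/= => scale.
set N := riem_norm _ _; rewrite leNgt; apply/negP => Nd.
have N0 : 0 < N by apply: lt_trans Nd; rewrite invr_gt0.
(* A radius above [m] has [q] in its ball, [s] in its time window, and [r ^- 2] below [N]. All three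
   numbers are below [r0], so an admissible radius above [m] exists. *)
pose m := Num.max (fine (dist (g t) p q))
  (Num.max (Num.sqrt (s - t)) (Num.sqrt N^-1)).
have dist_m : (dist (g t) p q <= (fine (dist (g t) p q))%:E)%E.
  by move: pq; rewrite /metric_ball/=; case: (dist _ _ _) => // _; exact: leNye.
have mr0 : m < r0.
  rewrite !gt_max; apply/and3P; split.
  - move: pq; rewrite /metric_ball/=.
    by case: (dist _ _ _) => [x| |]//=; rewrite lte_fin.
  - by rewrite ltr_sqrt// ltrD2r.
  - by rewrite ltr_sqrt// invf_plt ?posrE.
have /ereal_sup_gt[_ [r [r_gt0 Rmr] <-]] : (m%:E < ereal_sup [set r%:E | r in
    [set r : R | (0 < r)%R /\ Rm_lt g (parabolic_cylinder T g p t r) (r ^- 2)%R]])%E.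
  by apply: lt_le_trans scale; rewrite lte_fin.
rewrite lte_fin !gt_max => /and3P[dr sr Nr].
have sqr_lt x : Num.sqrt x < r -> x < r ^+ 2.
  move=> xr; have [x0|x0] := ltP x 0; first by rewrite (lt_trans x0) ?exprn_gt0.
  by rewrite -[x]sqr_sqrtr// ltr_sqr ?nnegrE ?sqrtr_ge0// ltW.
have : N < r ^- 2.
  apply: Rmr => //; split => /=.
    by rewrite /metric_ball/= (le_lt_trans dist_m)// lte_fin.
  have sr2 := sqr_lt _ sr; rewrite in_itv/= gt_max lt_min sT (le_lt_trans t0 ts).
  by rewrite !andbT; apply/andP; split; lra.
have : r ^- 2 < N by rewrite invf_plt ?posrE ?exprn_gt0//; exact: sqr_lt.
by move=> /lt_trans h /h; rewrite ltxx.
Qed.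

Theorem corollary2p4 (R : realType) (n : nat) (M : manifold R n) (T : R)
    (hT : 0 < T) (g : R -> tensor2 M) (hg : ricci_flow T g)
    (hyp : (forall t : R, 0 <= t < T ->
              exists C : R, Rm_le g ([set: M] `*` `[0, t]) C) \/
           (forall t : R, 0 <= t < T -> complete_metric (g t)))
    (p : M) :
  singular_set T g p <->
  (forall t : R, 0 <= t < T ->
     (((T - t)^-1)%:E < (riemann_scale T g p t ^+ 2)^-1)%E).
Proof.
split=> [sing t t0T|scale].
  have /andP[t0 tT] := t0T; have d0 : 0 < T - t by rewrite subr_gt0.
  rewrite lt_inve_sqr ?riemann_scale_ge0// ltNge; apply/negP => scale.
  have pB : nbhs p (metric_ball (g t) p (Num.sqrt (T - t))).
    by apply: nbhs_metric_ball; rewrite ?sqrtr_gt0//; exact: flow_metric hg _ _.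
  (* The curvature bound is available only at times strictly after [t], whereas [tau,T) contains its
     left end; the midpoint separates the two. *)
  apply: (sing _ pB ((t + T) / 2)).
    by rewrite divr_ge0 ?addr_ge0 ?(ltW hT)//= (midf_lt tT).2.
  exists (T - t)^-1 => q s [/= pq]; rewrite in_itv/= => /andP[ts sT] i.
  apply: riem_norm_le_scale pq _ => //.
  by rewrite sT (lt_le_trans _ ts)// midf_lt.
move=> U pU tau tauT [K RmK].
have [r0 r00 [tau1 /andP[tau_lt tau1T] ball_sub]] := metric_ball_sub hg pU tauT RmK.
have /andP[tau0 _] := tauT.
(* The remaining time [T - t]. The three bounds put the ball of radius sqrt(d) inside [U], the
   backward half of the cylinder (starting at t - d = T - 2d) after [tau1], and [K] strictly below
   1/d. *)
pose d := Num.min (r0 ^+ 2) (Num.min ((T - tau1) / 2) (`|K| + 1)^-1).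
have K1 : 0 < `|K| + 1 by rewrite ltr_wpDl.
have d0 : 0 < d.
  by rewrite !lt_min exprn_gt0// divr_gt0 ?subr_gt0// invr_gt0.
have [dr [dT dK]] : d <= r0 ^+ 2 /\ d <= (T - tau1) / 2 /\ d <= (`|K| + 1)^-1.
  by rewrite !ge_min !lexx !orbT.
pose t := T - d; have tE : T - t = d by rewrite /t; ring.
have tau1t : tau1 <= t - d by rewrite /t; lra.
have t0T : 0 <= t < T by apply/andP; split; lra.
have := scale t t0T; rewrite tE lt_inve_sqr ?riemann_scale_ge0//.
rewrite ltNge => /negP; apply; rewrite /riemann_scale; case: ifP => _.
  exact: leey.
have s0 : 0 < Num.sqrt d by rewrite sqrtr_gt0.
(* The radius sqrt(d) itself is admissible, so the scale is at least sqrt(T-t), against the strict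
   inequality. *)
rewrite le_max; apply/orP; right; apply: ereal_sup_ubound.
exists (Num.sqrt d) => //; split => // q s.
rewrite /parabolic_cylinder sqr_sqrtr ?(ltW d0)// => -[/= pq].
rewrite in_itv/= gt_max lt_min => /andP[/andP[ts _] /andP[_ sT]] i iq.
apply: (@le_lt_trans _ _ K).
  apply: RmK => //; split => /=; last by rewrite in_itv/= sT andbT; lra.
  apply: (ball_sub t); first by apply/andP; split; lra.
  apply: lt_le_trans pq _; rewrite lee_fin.
  by rewrite -[leRHS]ger0_norm ?(ltW r00)// -sqrtr_sqr ler_wsqrtr.
apply: (le_lt_trans (ler_norm K)).
apply: (@lt_le_trans _ _ (`|K| + 1)); first by rewrite ltrDl.
by rewrite -[leLHS]invrK lef_pV2 ?posrE// invr_gt0.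
Qed.
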